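(* Let $A,B\subseteq\mathbb{R}$ be two measurable sets satisfying $$(-\infty,\underline{\alpha}]\subseteq A^\circ\subseteq\overline{A}\subseteq(-\infty,\overline{\alpha})\quad\text{and}\quad[\overline{\beta},+\infty)\subseteq B^\circ\subseteq\overline{B}\subseteq(\underline{\beta},+\infty),$$ for some real numbers $\underline{\alpha}<\overline{\alpha}$ and $\underline{\beta}<\overline{\beta}$. Let $K:\mathbb{R}\to\mathbb{R}$ be a measurable, non-negative function and suppose that $$\mathcal{I}_K\big((-\infty,\overline{\alpha}),(\underline{\beta},+\infty)\big)<\infty.$$ Then $$\mathcal{I}_K(A_*,B^* )\le\mathcal{I}_K(A,B).$$ In addition, if $K$ is locally bounded from below by positive constants and $A=A_*$ (or $B=B^*$) up to sets of measure zero, then the inequality $\mathcal{I}_K(A_*,B^* )\le\mathcal{I}_K(A,B)$ is strict unless also $B=B^*$ (or, respectively, $A=A_*$) up to sets of measure zero.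
   Context: For measurable $A,B\subseteq\mathbb{R}$ and non-negative measurable $K$, $\mathcal{I}_K(A,B):=\int_A\int_BK(x-y)\,dx\,dy$, where $x$ ranges over $A$ and $y$ over $B$. $A^\circ$ and $\overline{A}$ denote the interior and the closure of $A$. $K$ is locally bounded from below by positive constants if $\inf_IK>0$ for every compact $I\subseteq\mathbb{R}$. If $A$ contains a half-line $(-\infty,\alpha)$ and is bounded above, its decreasing rearrangement is $A_*:=(-\infty,a_* )$ with $a_*:=\lim_{R\to+\infty}\left(\int_{-R}^R\chi_A(t)\,dt-R\right)$. If $B$ contains a half-line $(\beta,+\infty)$ and is bounded below, its increasing rearrangement is $B^*:=(b^*,+\infty)$ with $b^*:=\lim_{R\to+\infty}\left(R-\int_{-R}^R\chi_B(t)\,dt\right)$. *)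

(* Defs.v *)
From HB Require Import structures.
From mathcomp Require Import all_boot all_order all_algebra.
From mathcomp Require Import all_classical all_reals all_analysis.

Set Implicit Arguments.
Unset Strict Implicit.
Unset Printing Implicit Defensive.

Import Order.TTheory GRing.Theory Num.Theory.
Import numFieldNormedType.Exports.

Local Open Scope classical_set_scope.
Local Open Scope ring_scope.

(* The real line with the Lebesgue (not only Borel) sigma-algebra, i.e. the
   domain of [completed_lebesgue_measure]. Its carrier is convertible to [R],
   but the canonical sigma-algebra of [R] itself is the Borel one. *)
Definition lebesgueR (R : realType) : measurableType _ :=
  caratheodory_type ((@wlength R idfun)^*)%mu.

Section Defs.
Variable R : realType.
Implicit Types (A B : set R) (K : R -> R).

Local Notation mu := (@completed_lebesgue_measure R).

Definition lebesgue_set A : Prop := measurable (A : set (lebesgueR R)).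

(* The codomain of [K] carries the Borel sigma-algebra. *)
Definition lebesgue_fun K : Prop :=
  measurable_fun [set: lebesgueR R] (K : lebesgueR R -> R).

Definition interaction K A B : \bar R :=
  (\int[mu]_(x in A) \int[mu]_(y in B) (K (x - y))%:E)%E.

(* [ereal_inf] rather than the real-valued [inf], whose value is 0 on the empty
   set: the condition has to be vacuous at [I = set0]. *)
Definition locally_bounded_below K : Prop :=
  forall I : set R, compact I -> (0 < ereal_inf [set (K x)%:E | x in I])%E.

Definition dec_endpoint A : R :=
  lim ((\int[mu]_(t in [set` `[- r, r]]) \1_A t - r) @[r --> +oo]).

Definition dec_rearrangement A : set R := [set` `]-oo, dec_endpoint A[].

Definition inc_endpoint B : R :=
  lim ((r - \int[mu]_(t in [set` `[- r, r]]) \1_B t) @[r --> +oo]).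

Definition inc_rearrangement B : set R := [set` `]inc_endpoint B, +oo[].

Definition eq_up_to_null A B : Prop := mu (A `+` B) = 0%E.

End Defs.

(* Main.v *)
Require Import Defs.
From HB Require Import structures.
From mathcomp Require Import all_boot all_order all_algebra.
From mathcomp Require Import all_classical all_reals all_analysis.
From mathcomp Require Import measurable_realfun lra.

Import Order.TTheory GRing.Theory Num.Theory.
Import numFieldNormedType.Exports.

Local Open Scope classical_set_scope.
Local Open Scope ring_scope.

(* Write A_* = (-oo, a) and B^* = (b, +oo). By Tonelli, I_K(A, B) is the
   integral over z of K(z) |A n (B + z)|. For each z, inclusion-exclusion inside
   a window [l, u] containing the bounded parts of A and B + z gives
     |A n (B + z)| >= (a - l) + (u - z - b) - (u - l) = a - b - z,
   and the positive part of the right-hand side is |A_* n (B^* + z)|.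
   If A = A_* and B differs from B^*, then d := |B n (-oo, b]| > 0, hence
   |A n (B + z)| >= d for every z < a - b, while |A_* n (B^* + z)| < d / 2 for
   a - b - d / 2 < z < a - b; since K is bounded below there, the inequality is
   strict. The case B = B^* is symmetric. *)

(** * Null sets and Lebesgue outer measure *)

Section lebesgue_outer_measure.
Context {R : realType}.
Local Notation leb := (@lebesgue_measure R).
Implicit Types A B M : set R.

(** The value of [leb] at any set, Borel or not, is convertible to the outer measure generated by
    [wlength], so the laws of outer measures apply directly. *)
Lemma lebesgue_measure_ge0 A : (0 <= leb A)%E.
Proof. exact: (@outer_measure_ge0 _ _ ((@wlength R idfun)^*)%mu). Qed.

Lemma le_lebesgue_measure A B : A `<=` B -> (leb A <= leb B)%E.
Proof. exact: (@le_outer_measure _ _ ((@wlength R idfun)^*)%mu). Qed.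

Lemma lebesgue_measureU_le A B : (leb (A `|` B) <= leb A + leb B)%E.
Proof. exact: (@outer_measureU2 _ _ ((@wlength R idfun)^*)%mu). Qed.

Lemma lebesgue_measureU_null A B : leb A = 0%E -> leb B = 0%E ->
  leb (A `|` B) = 0%E.
Proof.
move=> A0 B0; apply/eqP; rewrite eq_le; apply/andP; split.
  by rewrite (le_trans (lebesgue_measureU_le _ _))// A0 B0 adde0.
exact: lebesgue_measure_ge0.
Qed.

Lemma le_lebesgue_measureU_null A B M : leb M = 0%E -> A `<=` B `|` M ->
  (leb A <= leb B)%E.
Proof.
move=> M0 /le_lebesgue_measure/le_trans; apply.
by apply: (le_trans (lebesgue_measureU_le _ _)); rewrite M0 adde0.
Qed.

Lemma lebesgue_measure_null_sub A M : leb M = 0%E -> A `<=` M -> leb A = 0%E.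
Proof.
move=> M0 /le_lebesgue_measure; rewrite M0 => A0; apply/eqP; rewrite eq_le A0/=.
exact: lebesgue_measure_ge0.
Qed.

Lemma lebesgue_measure_setD_null A M : leb M = 0%E -> leb (A `\` M) = leb A.
Proof.
move=> M0; apply/eqP; rewrite eq_le; apply/andP; split.
  exact: le_lebesgue_measure.
apply: (@le_trans _ _ (leb ((A `\` M) `|` M))).
  apply: le_lebesgue_measure => x Ax.
  by have [Mx|Mx] := pselect (M x); [right|left].
by apply: (le_trans (lebesgue_measureU_le _ _)); rewrite M0 adde0.
Qed.

Lemma lebesgue_measure_neq0_ge A : leb A <> 0%E ->
  exists2 d, 0 < d & (d%:E <= leb A)%E.
Proof.
move=> A0; have : (0 < leb A)%E.
  rewrite lt_neqAle eq_sym; apply/andP; split; first exact/eqP.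
  exact: lebesgue_measure_ge0.
case: (leb A) => // [r r0|_]; last by exists 1; rewrite ?leey.
by exists r; rewrite -?lte_fin.
Qed.

End lebesgue_outer_measure.

(** * Borel representatives of Lebesgue measurable sets and functions *)

Section borel_representatives.
Context {R : realType}.
Local Notation mu := (@completed_lebesgue_measure R).
Local Notation leb := (@lebesgue_measure R).
Implicit Types A : set R.

(** The Caratheodory sigma-algebra is the completion of the Borel one: [A] is a Borel set plus a
    part of a Borel null set [N], and removing [N] leaves a Borel set. *)
Lemma lebesgue_set_borel A : lebesgue_set A ->
  exists N : set R, [/\ measurable N, leb N = 0%E & measurable (A `\` N)].
Proof.
move=> mA.
have : (completed_algebra_gen leb).-sigma.-measurable A.
  by rewrite completed_caratheodory_measurable.
rewrite g_sigma_completed_algebra_genE => -[X mX [M [N [mN N0 MN]] <-]].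
exists N; split => //.
rewrite setDUl [X in _ `|` X](_ : _ = set0) ?setU0; first exact: measurableD.
by rewrite -subset0 => x [/MN].
Qed.

Lemma borel_lebesgue_set A : measurable A -> lebesgue_set A.
Proof. by move=> mA; exact: sub_caratheodory. Qed.

Lemma null_lebesgue_set A N : measurable N -> leb N = 0%E -> A `<=` N ->
  lebesgue_set A.
Proof.
move=> mN N0 AN; apply: negligible_sub_caratheodory.
by exists N; split => //; exact: borel_lebesgue_set.
Qed.

(** Preimages of the countably many rational rays determine measurability, so the union of their
    exceptional null sets is a single exceptional set for [K]. *)
Lemma lebesgue_fun_borel (K : R -> R) : lebesgue_fun K ->
  exists N : set R, [/\ measurable N, leb N = 0%E & measurable_fun (~` N) K].
Proof.
move=> mK.
have /choice[N NP] (q : rat) : exists N : set R,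
    [/\ measurable N, leb N = 0%E & measurable (K @^-1` `]ratr q, +oo[ `\` N)].
  apply: lebesgue_set_borel.
  rewrite /lebesgue_set -[X in measurable X]setTI.
  by apply: mK => //; exact: measurable_itv.
have mN : measurable (\bigcup_q N q).
  by apply: bigcupT_measurable_rat => q; have [] := NP q.
exists (\bigcup_q N q); split => //.
  apply: measure_negligible => //.
  (* The union is reindexed by natural numbers through [unpickle]; codes of no rational default to
     0, which only repeats a member of the family. *)
  have NE : \bigcup_q N q `<=` \bigcup_n N (odflt 0%R (unpickle n)).
    by move=> x [q _ Nqx]; exists (pickle q) => //; rewrite pickleK.
  apply: (@negligibleS _ (measurableTypeR R) R leb _ _ NE).
  apply: negligible_bigcup => n.
  have [mNn Nn0 _] := NP (odflt 0%R (unpickle n)).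
  exact/negligibleP.
apply: (measurability _ (RGenOInfty.measurableE R)).
move=> _ [_ [x ->]] <-.
(* By density, K(y) > x exactly when K(y) > q for some rational q > x. *)
rewrite (_ : _ `&` _ = (\bigcup_(q in [set q : rat | x < ratr q])
  (K @^-1` `]ratr q, +oo[ `\` N q)) `\` \bigcup_q N q).
  apply: measurableD => //.
  rewrite bigcup_mkcond; apply: bigcupT_measurable_rat => q.
  by case: ifPn => // _; have [] := NP q.
apply/seteqP; split => y /=.
  move=> [Ny]; rewrite in_itv/= andbT => xK; split => //.
  have [q] := rat_in_itvoo xK.
  rewrite in_itv/= => /andP[xq qK]; exists q => //=.
  split; first by rewrite in_itv/= qK.
  by move=> Nqy; apply: Ny; exists q.
move=> [[q /= xq [+ _]] Ny]; rewrite !in_itv/= !andbT => qK; split => //.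
exact: lt_trans qK.
Qed.

(** The identity from the Lebesgue to the Borel sigma-algebra pushes [mu] forward to [leb], which
    settles the Borel function [g]; then [f] equals [g] almost everywhere. *)
Lemma ge0_integral_completed (f g : R -> \bar R) (N : set R) :
  measurable N -> leb N = 0%E -> measurable_fun [set: R] g ->
  (forall x, 0 <= f x)%E -> (forall x, 0 <= g x)%E ->
  (forall x, ~ N x -> f x = g x) ->
  (\int[mu]_x f x = \int[leb]_x g x)%E.
Proof.
move=> mN N0 mg f0 g0 fg.
have mid : measurable_fun [set: lebesgueR R]
    (id : lebesgueR R -> measurableTypeR R).
  by move=> _ Y mY; rewrite setTI; exact: borel_lebesgue_set.
have mg' : measurable_fun [set: lebesgueR R] (g : lebesgueR R -> \bar R).
  by apply: (measurableT_comp mg mid).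
transitivity (\int[mu]_x g x)%E; last first.
  rewrite -[LHS](@ge0_integral_pushforward _ _ (lebesgueR R) (measurableTypeR R)
    R id mid mu setT g measurableT mg (fun x _ => g0 x)).
  exact: eq_measure_integral.
apply: ge0_ae_eq_integral => //.
  move=> _ Y mY; rewrite setTI.
  (* Off [N] the preimage is that of [g]; within [N] it is measurable by completeness. *)
  rewrite (_ : _ @^-1` _ = (g @^-1` Y `\` N) `|` (f @^-1` Y `&` N)).
    apply: measurableU.
      apply: measurableD; last exact: borel_lebesgue_set.
      by rewrite -[X in measurable X]setTI; exact: mg'.
    exact: (null_lebesgue_set _ N).
  apply/seteqP; split => x /=.
    move=> Yfx; have [Nx|Nx] := pselect (N x); [by right|left].
    by split => //=; rewrite -fg.
  by move=> [[Ygx Nx]|[]//]; rewrite /preimage/= fg.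
exists N; split => //; first exact: borel_lebesgue_set.
move=> x /= /not_implyP[_ fgx]; apply: contrapT => Nx; apply: fgx.
exact: fg.
Qed.

End borel_representatives.

(** * Invariance of Lebesgue measure under reflections *)

Section reflection.
Context {R : realType}.
Local Notation leb := (@lebesgue_measure R).
Implicit Types A B : set R.

Lemma measurable_subl (x : R) : measurable_fun [set: R] (fun y : R => x - y).
Proof. exact: measurable_funB. Qed.

Lemma measurable_preimage_subl (x : R) A : measurable A ->
  measurable ((fun y : R => x - y) @^-1` A).
Proof.
by move=> mA; rewrite -[X in measurable X]setTI; exact: measurable_subl.
Qed.

(** By uniqueness of Lebesgue measure it suffices to test the pushforward on intervals ]a, b]; the
    preimage [x - b, x - a[ has its open end on the other side but the same length. *)
Lemma lebesgue_measure_subl (x : R) A : measurable A ->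
  leb ((fun y : R => x - y) @^-1` A) = leb A.
Proof.
move=> mA.
pose phi : measurableTypeR R -> measurableTypeR R := fun y => x - y.
have mphi : measurable_fun setT phi by exact: measurable_subl.
pose mphi_mixin := isMeasurableFun.Build _ _ _ _ _ mphi.
pose mphi_pack : {mfun _ >-> _} := HB.pack phi mphi_mixin.
apply/esym.
apply: (@lebesgue_measure_unique _ (pushforward leb mphi_pack)) => //.
move=> _ [[a b]] _ <-.
transitivity (leb `[x - b, x - a[%classic).
  rewrite !lebesgue_measure_itv/= !lte_fin ltrD2l ltrN2 -!EFinB.
  rewrite (_ : x - a - (x - b) = b - a)//; lra.
congr (leb _); apply/seteqP.
by split => y /=; rewrite !in_itv/= /phi => /andP[? ?]; apply/andP; lra.
Qed.

End reflection.

(** * The overlap of a set with a translate, and Tonelli's theorem *)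

Section overlap.
Context {R : realType}.
Local Notation leb := (@lebesgue_measure R).
Implicit Types A B N : set R.

(** This is |A n (B + z)|, the cross-correlation of the indicators of [A] and [B]. *)
Definition overlap A B (z : R) : \bar R :=
  leb (A `&` (fun x : R => x - z) @^-1` B).

Lemma measurable_preimage_subr (z : R) A : measurable A ->
  measurable ((fun x : R => x - z) @^-1` A).
Proof.
move=> mA; rewrite -[X in measurable X]setTI.
have : measurable_fun [set: R] (fun x : R => x - z).
  exact: measurable_funB.
exact.
Qed.

(** A translation is a composite of two reflections: y - z = 0 - (z - y). *)
Lemma lebesgue_measure_subr (z : R) A : measurable A ->
  leb ((fun y : R => y - z) @^-1` A) = leb A.
Proof.
move=> mA.
rewrite -[RHS](lebesgue_measure_subl 0)// -[RHS](lebesgue_measure_subl z).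
  by congr (leb _); apply/seteqP; split => x /=; rewrite sub0r opprB.
exact: measurable_preimage_subl.
Qed.

Lemma ge0_integral_subl (x : R) (g : R -> \bar R) :
  measurable_fun [set: R] g -> (forall y, 0 <= g y)%E ->
  (\int[leb]_y g (x - y)%R = \int[leb]_y g y)%E.
Proof.
move=> mg g0.
have mphi : measurable_fun [set: measurableTypeR R]
    (fun y : measurableTypeR R => x - y : measurableTypeR R).
  exact: measurable_subl.
rewrite -[LHS](@ge0_integral_pushforward _ _ _ _ R _ mphi leb setT g)//.
by apply: eq_measure_integral => A mA _; exact: lebesgue_measure_subl.
Qed.

Section tonelli.
Context {k : R -> R} {A B : set R}.
Hypotheses (mk : measurable_fun [set: R] k) (k0 : forall x, 0 <= k x).
Hypotheses (mA : measurable A) (mB : measurable B).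

(** The integrand k(x - y) 1_A(x) 1_B(y) in the variables x and z = x - y. *)
Let F (xz : R * R) : \bar R :=
  (k xz.2 * \1_A xz.1 * \1_B (xz.1 - xz.2))%:E.

Let mF : measurable_fun [set: R * R] F.
Proof.
apply/measurable_EFinP; apply: measurable_funM.
  apply: measurable_funM.
    exact: measurableT_comp.
  apply: measurableT_comp => //.
apply: measurableT_comp => //.
exact: measurable_funB.
Qed.

Let F0 xz : (0 <= F xz)%E.
Proof. by rewrite lee_fin mulr_ge0// mulr_ge0// indicE ler0n. Qed.

Lemma measurable_overlap : measurable_fun [set: R] (overlap A B).
Proof.
have mS : measurable [set xz : R * R | (A xz.1 /\ B (xz.1 - xz.2))].
  apply: measurableI.
    by rewrite -[X in measurable X]setTI; exact: measurable_fst.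
  rewrite -[X in measurable X]setTI.
  have : measurable_fun [set: R * R] (fun xz : R * R => xz.1 - xz.2).
    exact: measurable_funB.
  exact.
apply: (eq_measurable_fun _ _ (measurable_fun_ysection leb mS)).
move=> z _ /=; congr (leb _).
by apply/seteqP; split => x /=; rewrite /ysection/= inE.
Qed.

(** For fixed x, the substitution y = x - z makes the kernel depend on z alone; exchanging the
    integrals then leaves the x-integral of the indicator of A n (B + z). *)
Lemma fubini_overlap :
  (\int[leb]_x \int[leb]_y (k (x - y) * \1_A x * \1_B y)%:E =
   \int[leb]_z ((k z)%:E * overlap A B z))%E.
Proof.
transitivity (\int[leb]_x \int[leb]_z F (x, z))%E.
  apply: eq_integral => x _.
  rewrite -(ge0_integral_subl x (fun z => F (x, z)))//.
    by apply: eq_integral => y _; rewrite /F/= subKr.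
  exact: measurable_fun_pair2 mF.
rewrite (@fubini_tonelli _ _ _ _ R leb leb F)//.
apply: eq_integral => z _; rewrite /F/=.
pose S := A `&` (fun x : R => x - z) @^-1` B.
have mS : measurable S.
  by apply: measurableI => //; exact: measurable_preimage_subr.
transitivity (\int[leb]_x ((k z)%:E * (\1_S x)%:E))%E.
  by apply: eq_integral => x _; rewrite -EFinM indicI -mulrA.
rewrite ge0_integralZl//.
- by rewrite integral_indic ?setIT.
- by apply/measurable_EFinP; exact: measurable_indic.
- by rewrite lee_fin.
Qed.

End tonelli.
End overlap.

(** * The interaction as a weighted integral of the overlap *)

Section interaction_overlap.
Context {R : realType}.
Local Notation mu := (@completed_lebesgue_measure R).
Local Notation leb := (@lebesgue_measure R).
Implicit Types A B N : set R.

(* [A], [B] and [K] are replaced by Borel representatives because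
   [(x, y) |-> x - y] is not measurable from the product of two Lebesgue
   sigma-algebras to the Lebesgue sigma-algebra. *)
Lemma interactionE (K : R -> R) A B N M P :
  (forall x, 0 <= K x) ->
  measurable N -> leb N = 0%E -> measurable_fun [set: R] (K \_ (~` N)) ->
  measurable M -> leb M = 0%E -> measurable (A `\` M) ->
  measurable P -> leb P = 0%E -> measurable (B `\` P) ->
  (interaction K A B =
   \int[leb]_z (((K \_ (~` N)) z)%:E * overlap (A `\` M) (B `\` P) z))%E.
Proof.
move=> K0 mN N0 mK mM M0 mA mP P0 mB; set k := K \_ _.
have k0 x : 0 <= k x by rewrite /k patchE; case: ifP.
pose G (xy : R * R) : \bar R :=
  (k (xy.1 - xy.2) * \1_(A `\` M) xy.1 * \1_(B `\` P) xy.2)%:E.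
have mG : measurable_fun [set: R * R] G.
  apply/measurable_EFinP; apply: measurable_funM.
    apply: measurable_funM.
      by apply: measurableT_comp => //; exact: measurable_funB.
    exact: measurableT_comp.
  exact: measurableT_comp.
have G0 xy : (0 <= G xy)%E.
  by rewrite lee_fin mulr_ge0// mulr_ge0.
have inner x : (A `\` M) x ->
    (\int[mu]_(y in B) (K (x - y)%R)%:E = \int[leb]_y G (x, y))%E.
  move=> Ax.
  rewrite integral_mkcond.
  (* For fixed x, the two integrands can differ only where y lies in [P] or x - y lies in [N]. *)
  apply: (ge0_integral_completed _ _ (P `|` (fun y => x - y) @^-1` N)).
  - by apply: measurableU => //; exact: measurable_preimage_subl.
  - by apply: lebesgue_measureU_null => //; rewrite lebesgue_measure_subl.
  - exact: measurable_fun_pair2 mG.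
  - by move=> y; rewrite patchE; case: ifP => // _; rewrite lee_fin.
  - by [].
  - move=> y /= /not_orP[Py Ny]; rewrite /G/= patchE.
    rewrite [\1_(A `\` M) x]indicE (mem_set Ax) mulr1 [\1__ y]indicE.
    rewrite /k patchE (mem_set (_ : (~` N) (x - y)))//.
    have [yB|yB] := boolP (y \in B).
      rewrite (_ : y \in _ = true) ?mulr1//.
      by apply/mem_set; split => //; exact: set_mem.
    rewrite (_ : y \in _ = false) ?mulr0//; apply/negbTE.
    by apply: contra yB => /set_mem[? _]; exact/mem_set.
rewrite /interaction -fubini_overlap// [LHS]integral_mkcond.
apply: (ge0_integral_completed _ _ M) => //.
- exact: (@measurable_fun_fubini_tonelli_F _ _ _ _ R leb G mG G0).
- move=> x; rewrite patchE; case: ifP => // _.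
  by apply: integral_ge0 => y _; rewrite lee_fin.
- by move=> x; apply: integral_ge0 => y _; exact: (G0 (x, y)).
- move=> x Mx; rewrite patchE; case: ifPn => xA.
    by apply: inner; split => //; exact: set_mem.
  rewrite integral0_eq// => y _.
  rewrite [\1__ x]indicE (_ : x \in _ = false) ?mulr0 ?mul0r//; apply/negbTE.
  by apply: contra xA => /set_mem[? _]; exact/mem_set.
Qed.

End interaction_overlap.

(** * Endpoints of the rearrangements as measures in a finite window *)

Section endpoints.
Context {R : realType}.
Local Notation leb := (@lebesgue_measure R).
Implicit Types (A B M : set R) (l u : R).

Lemma lebesgue_measure_window A l u : l <= u ->
  exists2 m, leb (A `&` `[l, u]) = m%:E & 0 <= m <= u - l.
Proof.
move=> lu.
have Alu : (leb (A `&` `[l, u]) <= (u - l)%:E)%E.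
  apply: (le_trans (le_lebesgue_measure _ _ (@subIsetr _ _ _))).
  rewrite lebesgue_measure_itv/= lte_fin; case: ltP => //.
  by rewrite lee_fin; lra.
have A0 : (0 <= leb (A `&` `[l, u]))%E by exact: lebesgue_measure_ge0.
case: (leb _) A0 Alu => //= m; rewrite !lee_fin => m0 mul.
by exists m => //; rewrite m0.
Qed.

(** Once [-r, r] contains [l, u], the set A n [-r, r] is the disjoint union of [-r, l[ and A n
    [l, u], so the expression under the limit is constantly l + |A n [l, u]|. *)
Lemma dec_endpointE A l u : lebesgue_set A -> l <= u ->
  `]-oo, l]%classic `<=` A -> A `<=` `]-oo, u[%classic ->
  leb (A `&` `[l, u]) = (dec_endpoint A - l)%:E.
Proof.
move=> mA lu lA Au; have [m mE _] := lebesgue_measure_window A _ _ lu.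
rewrite mE; congr (_%:E).
suff -> : dec_endpoint A = l + m by lra.
apply: cvg_lim => //; apply: cvg_near_cst.
near=> r.
have rl : - r < l by rewrite ltrNl; near: r; exact/nbhs_pinfty_gt/num_real.
have ru : u < r by near: r; exact/nbhs_pinfty_gt/num_real.
rewrite /Rintegral integral_indic//; last exact: borel_lebesgue_set.
have -> : A `&` `[- r, r] = `[- r, l[%classic `|` A `&` `[l, u].
  apply/seteqP; split => x /=; rewrite !in_itv/=.
    move=> [Ax /andP[rx xr]]; have := Au _ Ax; rewrite /= in_itv/=.
    by case: (ltP x l) => xl xu; [left|right; split => //];
      apply/andP; split; lra.
  case=> [/andP[rx xl]|[Ax /andP[lx xu]]]; split => //;
    try by apply/andP; split; lra.
  by apply: lA; rewrite /= in_itv/= ltW.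
transitivity (fine (l + r + m)%:E - r); last by rewrite /=; lra.
congr (fine _ - r).
rewrite measureU//.
- rewrite EFinD -mE; congr (_ + _)%E.
  transitivity (leb `[- r, l[%classic); first by [].
  by rewrite lebesgue_measure_itv/= lte_fin rl -EFinD opprK.
- exact: borel_lebesgue_set.
- by apply: measurableI => //; exact: borel_lebesgue_set.
- by apply/seteqP; split => x //=; rewrite !in_itv/= => -[? [? ?]]; lra.
Unshelve. all: by end_near. Qed.

(** Here B n [-r, r] splits into ]u, r] and B n [l, u], and the limit is u - |B n [l, u]|. *)
Lemma inc_endpointE B l u : lebesgue_set B -> l <= u ->
  B `<=` `]l, +oo[%classic -> `[u, +oo[%classic `<=` B ->
  leb (B `&` `[l, u]) = (u - inc_endpoint B)%:E.
Proof.
move=> mB lu lB Bu; have [m mE _] := lebesgue_measure_window B _ _ lu.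
rewrite mE; congr (_%:E).
suff -> : inc_endpoint B = u - m by lra.
apply: cvg_lim => //; apply: cvg_near_cst.
near=> r.
have rl : - r < l by rewrite ltrNl; near: r; exact/nbhs_pinfty_gt/num_real.
have ru : u < r by near: r; exact/nbhs_pinfty_gt/num_real.
rewrite /Rintegral integral_indic//; last exact: borel_lebesgue_set.
have -> : B `&` `[- r, r] = `]u, r]%classic `|` B `&` `[l, u].
  apply/seteqP; split => x /=; rewrite !in_itv/=.
    move=> [Bx /andP[rx xr]]; have := lB _ Bx; rewrite /= in_itv/= andbT.
    by case: (ltP u x) => xl xu; [left|right; split => //];
      apply/andP; split; lra.
  case=> [/andP[rx xl]|[Ax /andP[lx xu]]]; split => //;
    try by apply/andP; split; lra.
  by apply: Bu; rewrite /= in_itv/= ltW.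
transitivity (r - fine (r - u + m)%:E); last by rewrite /=; lra.
congr (r - fine _).
rewrite measureU//.
- rewrite EFinD -mE; congr (_ + _)%E.
  transitivity (leb `]u, r]%classic); first by [].
  by rewrite lebesgue_measure_itv/= lte_fin ru -EFinD.
- exact: borel_lebesgue_set.
- by apply: measurableI => //; exact: borel_lebesgue_set.
- by apply/seteqP; split => x //=; rewrite !in_itv/= => -[? [? ?]]; lra.
Unshelve. all: by end_near. Qed.

End endpoints.

(** * Pointwise lower bound for the overlap *)

Section overlap_bounds.
Context {R : realType}.
Local Notation leb := (@lebesgue_measure R).
Implicit Types (A B M : set R) (l u z : R).

Lemma overlap_ray (a b z : R) :
  overlap `]-oo, a[ `]b, +oo[ z = (Num.max 0 (a - b - z))%:E.
Proof.
rewrite /overlap (_ : _ `&` _ = `]b + z, a[%classic); last first.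
  by apply/seteqP; split => x /=; rewrite !in_itv/= ?andbT;
    [move=> [? ?]; apply/andP|move=> /andP[? ?]]; split; lra.
rewrite lebesgue_measure_itv/= lte_fin; case: ltP => abz.
  by rewrite -EFinD max_r; [congr (_%:E)|]; lra.
by rewrite max_l//; lra.
Qed.

Lemma le_overlap A A' B B' z : A `<=` A' -> B `<=` B' ->
  (overlap A B z <= overlap A' B' z)%E.
Proof.
by move=> AA' BB'; apply: le_lebesgue_measure => x [/AA' ? /BB' ?].
Qed.

(** The hypotheses cover all large windows because one window must serve both [A] and the translate
    of [B], and so depends on [z]. *)
Lemma overlap_ge A B (a b l0 u0 l1 u1 z : R) : measurable A -> measurable B ->
  (forall l u, l <= l0 -> u0 <= u -> l <= u ->
    leb (A `&` `[l, u]) = (a - l)%:E) ->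
  (forall l u, l <= l1 -> u1 <= u -> l <= u ->
    leb (B `&` `[l, u]) = (u - b)%:E) ->
  (overlap `]-oo, a[ `]b, +oo[ z <= overlap A B z)%E.
Proof.
move=> mA mB hA hB; rewrite overlap_ray.
rewrite EFin_max ge_max; apply/andP; split.
  exact: lebesgue_measure_ge0.
(* The bounds for [B] are shifted by [z]. As [l0] enters both [l] and [u], the order l <= l0 <= u is
   automatic. *)
pose l := Num.min (Num.min l0 u0) (Num.min l1 u1 + z).
pose u := Num.max (Num.max l0 u0) (Num.max l1 u1 + z).
have [ll0 ll1] : l <= l0 /\ l - z <= l1.
  by rewrite lerBlDr /l !ge_min; split; rewrite ?lerD2r ?ge_min ?lexx ?orbT.
have [uu0 uu1] : u0 <= u /\ u1 <= u - z.
  by rewrite lerBrDr /u !le_max; split; rewrite ?lerD2r ?le_max ?lexx ?orbT.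
have lu : l <= u.
  by apply: (@le_trans _ _ l0) => //; rewrite /u !le_max lexx.
pose C := (fun x : R => x - z) @^-1` B.
have mC : measurable C by exact: measurable_preimage_subr.
have CE : leb (C `&` `[l, u]) = (u - z - b)%:E.
  rewrite -(hB (l - z) (u - z))//; last by rewrite lerD2r.
  rewrite -(lebesgue_measure_subr z (B `&` _))//; last exact: measurableI.
  congr (leb _); apply/seteqP.
  by split => x /=; rewrite !in_itv/= => -[Cx /andP[? ?]]; split => //;
    apply/andP; split; lra.
have AE := hA _ _ ll0 uu0 lu.
have Aoo : (leb (A `&` `[l, u]) < +oo)%E by rewrite AE ltry.
apply: (@le_trans _ _ (leb ((A `&` C) `&` `[l, u]))); last first.
  by apply: le_lebesgue_measure => x [].
have [m mE m0] := lebesgue_measure_window (A `&` C) _ _ lu.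
have [n nE n0] := lebesgue_measure_window (A `|` C) _ _ lu.
have mI : measurable (`[l, u]%classic : set R) by exact: measurable_itv.
(* Inclusion-exclusion; the union has measure n <= u - l, whence m >= a - b - z. *)
have : leb ((A `|` C) `&` `[l, u]) =
    (leb (A `&` `[l, u]) + leb (C `&` `[l, u]) - leb ((A `&` C) `&` `[l, u]))%E.
  rewrite setIUl setIIl; apply: measureUfinl.
  - exact: measurableI.
  - exact: measurableI.
  - exact: Aoo.
rewrite AE CE mE nE -!EFinD => -[nE'].
by rewrite lee_fin; lra.
Qed.

(** As |J| is finite, |J \ A| is the difference of |J| and |A n J|, which coincide. *)
Lemma lebesgue_measure_full_setD A J (c : R) : measurable A -> measurable J ->
  leb J = c%:E -> (c%:E <= leb (A `&` J))%E -> leb (J `\` A) = 0%E.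
Proof.
move=> mA mJ Jc cA.
have Joo : (leb J < +oo)%E by rewrite Jc ltry.
have AJ : leb (A `&` J) = c%:E.
  apply/eqP; rewrite eq_le cA -Jc andbT.
  by apply: le_lebesgue_measure => x [].
rewrite [LHS]measureD//.
  transitivity (c%:E - leb (A `&` J))%E; last by rewrite AJ -EFinB subrr.
  by rewrite setIC; congr (_ - _)%E.
Qed.

End overlap_bounds.

(** * Strict inequality from a gap between overlaps *)

Section strictness.
Context {R : realType}.
Local Notation leb := (@lebesgue_measure R).
Implicit Types (A B N : set R).

(** The infimum over [c, d] is positive, and its comparison with K(c) makes it a real number. *)
Lemma locally_bounded_below_itv (K : R -> R) (c d : R) :
  locally_bounded_below K -> c <= d ->
  exists2 m, 0 < m & forall x, c <= x <= d -> m <= K x.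
Proof.
move=> KI cd.
have := KI `[c, d]%classic (@segment_compact _ c d).
set i := ereal_inf _ => i0.
have iK x : c <= x <= d -> (i <= (K x)%:E)%E.
  by move=> cxd; apply: ereal_inf_lbound; exists x => //=; rewrite in_itv.
have := iK c; rewrite lexx cd => /(_ isT).
case: i i0 iK => [r| |] // r0 rK _; exists r; first by rewrite -lte_fin.
by move=> x /rK; rewrite lee_fin.
Qed.

(** Between the two integrands fits a bump of height m d / 2 on an interval of length d / 2, where m
    bounds [K] from below. Finiteness of the smaller integral makes adding the bump a strict
    increase. *)
Lemma integral_overlap_lt (K : R -> R) A B N (a b d : R) :
  (forall x, 0 <= K x) -> locally_bounded_below K ->
  measurable N -> leb N = 0%E -> measurable_fun [set: R] (K \_ (~` N)) ->
  measurable A -> measurable B -> 0 < d ->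
  (forall z, overlap `]-oo, a[ `]b, +oo[ z <= overlap A B z)%E ->
  (forall z, a - b - d / 2 < z < a - b -> (d%:E <= overlap A B z)%E) ->
  (\int[leb]_z (((K \_ (~` N)) z)%:E * overlap `]-oo, a[ `]b, +oo[ z)
     < +oo)%E ->
  (\int[leb]_z (((K \_ (~` N)) z)%:E * overlap `]-oo, a[ `]b, +oo[ z) <
   \int[leb]_z (((K \_ (~` N)) z)%:E * overlap A B z))%E.
Proof.
move=> K0 Klb mN N0; set k := K \_ _ => mk mA mB d0 le_ov ge_d fin.
have k0 x : 0 <= k x by rewrite /k patchE; case: ifP.
have [m m0 mK] : exists2 m, 0 < m &
    forall x, a - b - d / 2 <= x <= a - b -> m <= K x.
  by apply: locally_bounded_below_itv => //; lra.
(* The set [N] is removed because [k] vanishes there; the measure d / 2 is unchanged. *)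
pose J := `]a - b - d / 2, a - b[%classic `\` N.
have mJ : measurable J by apply: measurableD => //; exact: measurable_itv.
(* [psi] fits between the two integrands. *)
pose psi x : \bar R := ((m * (d / 2)) * \1_J x)%:E.
have mov A' B' : measurable A' -> measurable B' ->
    measurable_fun [set: R] (fun z => (k z)%:E * overlap A' B' z)%E.
  move=> mA' mB'; apply: emeasurable_funM; first exact/measurable_EFinP.
  exact: measurable_overlap.
have ov0 A' B' z : (0 <= (k z)%:E * overlap A' B' z)%E.
  apply: mule_ge0; first by rewrite lee_fin.
  exact: lebesgue_measure_ge0.
have mpsi : measurable_fun [set: R] psi.
  apply/measurable_EFinP; apply: measurable_funM => //;
    exact: measurable_indic.
have psi0 x : (0 <= psi x)%E.
  by rewrite lee_fin mulr_ge0// mulr_ge0 ?ltW// divr_gt0.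
have md0 : 0 < m * (d / 2) by rewrite mulr_gt0// divr_gt0.
have psiE : (\int[leb]_x psi x = (m * (d / 2) * (d / 2))%:E)%E.
  rewrite /psi.
  under eq_integral do rewrite EFinM.
  rewrite ge0_integralZl//; last 2 first.
  - by apply/measurable_EFinP; exact: measurable_indic.
  - by rewrite lee_fin ltW.
  rewrite integral_indic// setIT.
  rewrite [in RHS]EFinM; congr (_ * _)%E.
  transitivity (leb J); first by [].
  rewrite lebesgue_measure_setD_null// lebesgue_measure_itv/= lte_fin.
  by rewrite ifT; [rewrite -EFinD; congr (_%:E)|]; lra.
apply: (@lt_le_trans _ _ (\int[leb]_z ((k z)%:E * overlap `]-oo, a[ `]b, +oo[ z)
   + \int[leb]_z psi z)%E).
  rewrite psiE lteDl//.
    by rewrite lte_fin mulr_gt0// divr_gt0.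
  by rewrite ge0_fin_numE// integral_ge0.
rewrite -ge0_integralD//; last exact: mov.
apply: ge0_le_integral => //.
- by move=> z _; rewrite adde_ge0.
- by apply: emeasurable_funD => //; exact: mov.
- exact: mov.
move=> z _; rewrite /psi indicE.
case: (boolP (z \in J)) => [/set_mem[/= zJ Nz]|_].
  move: (zJ); rewrite in_itv/= => /andP[z1 z2].
  have kz : m <= k z.
    by rewrite /k patchE mem_set// mK// !ltW.
  rewrite mulr1 overlap_ray max_r; last by lra.
  apply: (@le_trans _ _ ((k z)%:E * d%:E)%E).
    (* The bump m (d / 2) and the ray term k(z) (a - b - z) are each at most k(z) (d / 2). *)
    rewrite -!EFinM -EFinD lee_fin.
    have : m * (d / 2) <= k z * (d / 2) by rewrite ler_wpM2r// divr_ge0// ltW.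
    have : k z * (a - b - z) <= k z * (d / 2) by rewrite ler_wpM2l//; lra.
    lra.
  by apply: lee_wpmul2l; [rewrite lee_fin|apply: ge_d; rewrite z1 z2].
rewrite mulr0 adde0; apply: lee_wpmul2l; first by rewrite lee_fin.
exact: le_ov.
Qed.

End strictness.

(** * Null modifications and equality with the rearrangement *)

Section rearrangement_null.
Context {R : realType}.
Local Notation leb := (@lebesgue_measure R).
Implicit Types (A B M : set R) (l u : R).

Lemma lebesgue_measure_subr_null A z : lebesgue_set A -> leb A = 0%E ->
  leb ((fun x => x - z) @^-1` A) = 0%E.
Proof.
move=> /lebesgue_set_borel[N [mN N0 mAN]] A0.
apply: (lebesgue_measure_null_sub _ ((fun x => x - z) @^-1` (A `\` N) `|`
    (fun x => x - z) @^-1` N)).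
  apply: lebesgue_measureU_null; rewrite lebesgue_measure_subr//.
  by rewrite lebesgue_measure_setD_null.
by move=> x /= Ax; have [Nx|Nx] := pselect (N (x - z)); [right|left].
Qed.

(** All errors lie in the union of [M] and its translate M + z, which is null. *)
Lemma le_overlap_null A A' B B' M z : lebesgue_set M ->
  leb M = 0%E -> A `<=` A' `|` M -> B `<=` B' `|` M ->
  (overlap A B z <= overlap A' B' z)%E.
Proof.
move=> mM M0 AA' BB'.
apply: (le_lebesgue_measureU_null _ _ (M `|` (fun x => x - z) @^-1` M)).
  by apply: lebesgue_measureU_null => //; exact: lebesgue_measure_subr_null.
by move=> x [/AA'[A'x|Mx] /BB'[B'x|Mxz]];
  [left|right; right|right; left|right; left].
Qed.

(** The measure of [B] in [l, u] is u - b, the length of ]b, u]. Without mass to the left of b, [B]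
    must fill ]b, u], and it contains everything beyond u. *)
Lemma inc_rearrangement_null B M l u : lebesgue_set B -> l <= u ->
  B `<=` `]l, +oo[%classic -> `[u, +oo[%classic `<=` B ->
  leb M = 0%E -> measurable (B `\` M) ->
  leb ((B `\` M) `&` `]-oo, inc_endpoint B]) = 0%E ->
  eq_up_to_null B (inc_rearrangement B).
Proof.
move=> mB lu lB uB M0 mBM; rewrite /inc_rearrangement.
have := inc_endpointE _ _ _ mB lu lB uB.
set b := inc_endpoint B => bE Bb0.
have [m mE mlu] := lebesgue_measure_window B _ _ lu.
(* With m >= 0 this gives b <= u, so that ]b, u] has length u - b. *)
have mb : m = u - b by move: bE; rewrite mE => -[].
have JE : leb `]b, u]%classic = (u - b)%:E.
  rewrite lebesgue_measure_itv/= lte_fin; case: ltP => //= ub.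
  by congr (_%:E); lra.
have J0 : leb (`]b, u]%classic `\` (B `\` M)) = 0%E.
  apply: (@lebesgue_measure_full_setD _ _ _ (u - b)) => //.
  rewrite -bE; apply: (le_lebesgue_measureU_null _ _
    (M `|` (B `\` M) `&` `]-oo, b]%classic)).
    exact: lebesgue_measureU_null.
  move=> x [Bx]; rewrite /= !in_itv/= => /andP[lx xu].
  have [Mx|Mx] := pselect (M x); first by right; left.
  by case: (leP x b) => xb; [right; right|left]; split => //; rewrite xu.
(* The symmetric difference consists of points of [B] up to b and points of ]b, u] missed by [B]. *)
apply: (lebesgue_measure_null_sub _ ((M `|` (B `\` M) `&` `]-oo, b]%classic)
  `|` (`]b, u]%classic `\` (B `\` M)))).
  by apply: lebesgue_measureU_null => //; exact: lebesgue_measureU_null.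
move=> x; rewrite /= !in_itv/= !andbT => -[[Bx xb]|[bx Bx]].
  left; have [Mx|Mx] := pselect (M x); [by left|right]; split => //.
  by rewrite leNgt; apply/negP.
right; split; last by case.
rewrite bx/= leNgt; apply/negP => ux; apply: Bx; apply: uB.
by rewrite /= in_itv/= ltW.
Qed.

(** Mirror image: [A] has measure a - l in [l, u], must fill [l, a[, and contains everything below
    l. *)
Lemma dec_rearrangement_null A M l u : lebesgue_set A -> l <= u ->
  `]-oo, l]%classic `<=` A -> A `<=` `]-oo, u[%classic ->
  leb M = 0%E -> measurable (A `\` M) ->
  leb ((A `\` M) `&` `[dec_endpoint A, +oo[) = 0%E ->
  eq_up_to_null A (dec_rearrangement A).
Proof.
move=> mA lu lA uA M0 mAM; rewrite /dec_rearrangement.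
have := dec_endpointE _ _ _ mA lu lA uA.
set a := dec_endpoint A => aE Aa0.
have [m mE mlu] := lebesgue_measure_window A _ _ lu.
have ma : m = a - l by move: aE; rewrite mE => -[].
have JE : leb `[l, a[%classic = (a - l)%:E.
  rewrite lebesgue_measure_itv/= lte_fin; case: ltP => //= la.
  by congr (_%:E); lra.
have J0 : leb (`[l, a[%classic `\` (A `\` M)) = 0%E.
  apply: (@lebesgue_measure_full_setD _ _ _ (a - l)) => //.
  rewrite -aE; apply: (le_lebesgue_measureU_null _ _
    (M `|` (A `\` M) `&` `[a, +oo[%classic)).
    exact: lebesgue_measureU_null.
  move=> x [Ax]; rewrite /= !in_itv/= !andbT => /andP[lx xu].
  have [Mx|Mx] := pselect (M x); first by right; left.
  by case: (leP a x) => xb; [right; right|left]; split => //; rewrite lx.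
apply: (lebesgue_measure_null_sub _ ((M `|` (A `\` M) `&` `[a, +oo[%classic)
  `|` (`[l, a[%classic `\` (A `\` M)))).
  by apply: lebesgue_measureU_null => //; exact: lebesgue_measureU_null.
move=> x; rewrite /= !in_itv/= !andbT => -[[Ax xa]|[ax Ax]].
  left; have [Mx|Mx] := pselect (M x); [by left|right]; split => //.
  by rewrite leNgt; apply/negP.
right; split; last by case.
rewrite ax andbT leNgt; apply/negP => ux; apply: Ax; apply: lA.
by rewrite /= in_itv/= ltW.
Qed.

End rearrangement_null.

(** * The rearrangement inequality and its strict form *)

Theorem proposition6p1 (R : realType) (A B : set R)
    (alphaL alphaU betaL betaU : R) (K : R -> R)
    (mA : lebesgue_set A) (mB : lebesgue_set B)
    (lt_alpha : alphaL < alphaU) (lt_beta : betaL < betaU)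
    (A_lower : [set` `]-oo, alphaL]] `<=` interior A)
    (A_upper : closure A `<=` [set` `]-oo, alphaU[])
    (B_upper : [set` `[betaU, +oo[] `<=` interior B)
    (B_lower : closure B `<=` [set` `]betaL, +oo[])
    (mK : lebesgue_fun K) (K_ge0 : forall x, 0 <= K x)
    (K_fin : (interaction K [set` `]-oo, alphaU[] [set` `]betaL, +oo[]
              < +oo)%E) :
  (interaction K (dec_rearrangement A) (inc_rearrangement B)
     <= interaction K A B)%E /\
  (locally_bounded_below K ->
    (eq_up_to_null A (dec_rearrangement A) ->
      ~ eq_up_to_null B (inc_rearrangement B) ->
      (interaction K (dec_rearrangement A) (inc_rearrangement B)
         < interaction K A B)%E) /\
    (eq_up_to_null B (inc_rearrangement B) ->
      ~ eq_up_to_null A (dec_rearrangement A) ->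
      (interaction K (dec_rearrangement A) (inc_rearrangement B)
         < interaction K A B)%E)).
Proof.
have {A_lower} Al : `]-oo, alphaL]%classic `<=` A.
  by move=> x /A_lower; exact: interior_subset.
have {A_upper} Au : A `<=` `]-oo, alphaU[%classic.
  by move=> x Ax; apply: A_upper; exact: subset_closure.
have {B_upper} Bu : `[betaU, +oo[%classic `<=` B.
  by move=> x /B_upper; exact: interior_subset.
have {B_lower} Bl : B `<=` `]betaL, +oo[%classic.
  by move=> x Bx; apply: B_lower; exact: subset_closure.
have [N [mN N0 mKN]] := lebesgue_fun_borel _ mK.
have [M [mM M0 mAM]] := lebesgue_set_borel _ mA.
have [P [mP P0 mBP]] := lebesgue_set_borel _ mB.
have {mK mKN} mk : measurable_fun [set: R] (K \_ (~` N)).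
  exact/(measurable_restrictT _ (measurableC mN)).
pose k := K \_ (~` N).
have k0 x : 0 <= k x by rewrite /k patchE; case: ifP.
pose I A' B' := (\int[@lebesgue_measure R]_z ((k z)%:E * overlap A' B' z))%E.
have IE A' B' M' P' : measurable M' -> lebesgue_measure M' = 0%E ->
    measurable (A' `\` M') -> measurable P' -> lebesgue_measure P' = 0%E ->
    measurable (B' `\` P') -> interaction K A' B' = I (A' `\` M') (B' `\` P').
  by move=> *; exact: interactionE.
have IE0 A' B' : measurable A' -> measurable B' ->
    interaction K A' B' = I A' B'.
  move=> mA' mB'; rewrite (IE _ _ set0 set0) ?setD0//; exact: measure0.
have le_I A1 B1 A2 B2 : measurable A1 -> measurable B1 ->
    measurable A2 -> measurable B2 ->
    (forall z, overlap A1 B1 z <= overlap A2 B2 z)%E -> (I A1 B1 <= I A2 B2)%E.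
  move=> mA1 mB1 mA2 mB2 le12; apply: ge0_le_integral => //.
  - move=> z _; apply: mule_ge0; first by rewrite lee_fin.
    exact: lebesgue_measure_ge0.
  - apply: emeasurable_funM; first exact/measurable_EFinP.
    exact: measurable_overlap.
  - apply: emeasurable_funM; first exact/measurable_EFinP.
    exact: measurable_overlap.
  - by move=> z _; apply: lee_wpmul2l; rewrite ?lee_fin.
have mray (a : R) : measurable `]-oo, a[%classic by exact: measurable_itv.
have mray' (a : R) : measurable `]a, +oo[%classic by exact: measurable_itv.
rewrite /dec_rearrangement /inc_rearrangement.
set a := dec_endpoint A; set b := inc_endpoint B.
rewrite (IE0 `]-oo, a[%classic)// (IE A B M P)//.
have ov_ge z :
    (overlap `]-oo, a[ `]b, +oo[ z <= overlap (A `\` M) (B `\` P) z)%E.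
  (* Removing a null set preserves measures in windows, so the endpoint formulas for [A] and [B]
     carry over to their Borel representatives. *)
  apply: (overlap_ge _ _ _ _ alphaL alphaU betaL betaU) => // l u ll uu lu.
  - rewrite setDE setIAC -setDE lebesgue_measure_setD_null//.
    apply: dec_endpointE => //.
    + move=> x /=; rewrite in_itv/= => xl; apply: Al.
      by rewrite /= in_itv/= (le_trans xl).
    + by move=> x /Au /=; rewrite !in_itv/= => /lt_le_trans; apply.
  - rewrite setDE setIAC -setDE lebesgue_measure_setD_null//.
    apply: inc_endpointE => //.
    + by move=> x /Bl /=; rewrite !in_itv/= !andbT; apply: le_lt_trans.
    + move=> x /=; rewrite in_itv/= andbT => ux; apply: Bu.
      by rewrite /= in_itv/= andbT (le_trans uu).
have I_le :
    (I `]-oo, a[%classic `]b, +oo[%classic <= I (A `\` M) (B `\` P))%E.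
  exact: le_I.
split=> // Klb.
(* The chain passes through I(A, B), which the interaction of the enclosing rays dominates. *)
have I_fin : (I `]-oo, a[%classic `]b, +oo[%classic < +oo)%E.
  apply: (le_lt_trans I_le); apply: le_lt_trans K_fin.
  rewrite IE0//; apply: le_I => // z.
  by apply: le_overlap => x []; [move=> /Au|move=> /Bl].
split=> AB0 BA0.
- have [d d0 dB] : exists2 d : R, 0 < d &
      (d%:E <= lebesgue_measure ((B `\` P) `&` `]-oo, b]))%E.
    apply: lebesgue_measure_neq0_ge => b0; apply: BA0.
    by apply: (inc_rearrangement_null _ P betaL betaU) => //; exact: ltW.
  apply: (integral_overlap_lt _ _ _ _ _ _ d) => // z /andP[z1 z2].
  (* The ray ]-oo, a[ lies in [A] without [M] up to a null set, so it may stand in for it. *)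
  apply: (@le_trans _ _ (overlap `]-oo, a[ (B `\` P) z)); last first.
    apply: (le_overlap_null _ _ _ _ (M `|` (A `+` `]-oo, a[%classic))).
    + apply: measurableU; first exact: borel_lebesgue_set.
      by apply: measurableU; apply: measurableD => //;
        exact: borel_lebesgue_set.
    + exact: lebesgue_measureU_null.
    + move=> x xa; have [Mx|Mx] := pselect (M x); first by right; left.
      by have [Ax|Ax] := pselect (A x); [left|right; right; right].
    + by move=> x; left.
  apply: (le_trans dB).
  (* Shifted by z < a - b, the part of [B] up to b lands at or below b + z < a, inside the ray. *)
  rewrite -(lebesgue_measure_subr z); last first.
    by apply: measurableI => //; exact: measurable_itv.
  apply: le_lebesgue_measure => x [/= Bx].
  by rewrite in_itv/= => xb; split => //; rewrite /= in_itv/=; lra.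
- have [d d0 dA] : exists2 d : R, 0 < d &
      (d%:E <= lebesgue_measure ((A `\` M) `&` `[a, +oo[))%E.
    apply: lebesgue_measure_neq0_ge => a0; apply: BA0.
    by apply: (dec_rearrangement_null _ M alphaL alphaU) => //; exact: ltW.
  apply: (integral_overlap_lt _ _ _ _ _ _ d) => // z /andP[z1 z2].
  apply: (@le_trans _ _ (overlap (A `\` M) `]b, +oo[ z)); last first.
    apply: (le_overlap_null _ _ _ _ (P `|` (B `+` `]b, +oo[%classic))).
    + apply: measurableU; first exact: borel_lebesgue_set.
      by apply: measurableU; apply: measurableD => //;
        exact: borel_lebesgue_set.
    + exact: lebesgue_measureU_null.
    + by move=> x; left.
    + move=> x xb; have [Px|Px] := pselect (P x); first by right; left.
      by have [Bx|Bx] := pselect (B x); [left|right; right; right].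
  apply: (le_trans dA).
  (* If x >= a and z < a - b, then x - z > b, so x lies in the translated ray. *)
  apply: le_lebesgue_measure => x [/= Ax].
  by rewrite in_itv/= andbT => xa; split => //; rewrite /= in_itv/= andbT; lra.
Qed.
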